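(* Suppose $(X,\perp)$ is an orthogonality space and $(Y,\|\cdot\|)$ is a real Banach space. Let $f_1,f_2,f_3:X\to Y$ be mappings such that, for some real number $\epsilon$, $$\|f_1(x+y)-f_2(x)-f_3(y)\|\le\epsilon$$ for all $x,y\in X$ with $x\perp y$. Then there exist exactly one quadratic mapping $Q:X\to Y$ and exactly one additive mapping $T:X\to Y$ such that, for all $x\in X$, $$\|f_1(x)-f_1(0)-Q(x)-T(x)\|\le\tfrac{68}{3}\epsilon,$$ $$\|f_2(x)-f_2(0)-Q(x)-T(x)\|\le\tfrac{80}{3}\epsilon,$$ $$\|f_3(x)-f_3(0)-Q(x)-T(x)\|\le\tfrac{80}{3}\epsilon.$$
   Context: An orthogonality space $(X,\perp)$ (in the sense of R\''atz) is a real vector space $X$ with $\dim X\ge 2$ and a binary relation $\perp$ on $X$ satisfying: (O1) $x\perp 0$ and $0\perp x$ for all $x\in X$; (O2) if $x,y\in X\setminus\{0\}$ and $x\perp y$, then $x,y$ are linearly independent; (O3) if $x\perp y$, then $\alpha x\perp\beta y$ for all $\alpha,\beta\in\mathbf{R}$; (O4) if $P$ is a $2$-dimensional subspace of $X$, $x\in P$ and $\lambda\in[0,\infty)$, then there exists $y_0\in P$ such that $x\perp y_0$ and $x+y_0\perp\lambda x-y_0$. A mapping $T:X\to Y$ is additive if $T(x+y)=T(x)+T(y)$ for all $x,y\in X$; a mapping $Q:X\to Y$ is quadratic if $Q(x+y)+Q(x-y)=2Q(x)+2Q(y)$ for all $x,y\in X$. *)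

(* Defs.v *)
From mathcomp Require Import all_boot all_order all_algebra.
From mathcomp Require Import all_classical all_reals all_analysis.

Set Implicit Arguments.
Unset Strict Implicit.
Unset Printing Implicit Defensive.

Import Order.TTheory GRing.Theory Num.Theory.
Import numFieldNormedType.Exports.

Local Open Scope classical_set_scope.
Local Open Scope ring_scope.

Definition lin_indep2 (R : realType) (X : lmodType R) (a b : X) : Prop :=
  forall s t : R, s *: a + t *: b = 0 -> s = 0 /\ t = 0.

Definition is_subspace (R : realType) (X : lmodType R) (P : set X) : Prop :=
  [/\ P 0,
      forall x y, P x -> P y -> P (x + y)
    & forall (s : R) x, P x -> P (s *: x)].

Definition is_plane (R : realType) (X : lmodType R) (P : set X) : Prop :=
  is_subspace P /\
  exists a b : X,
    [/\ P a, P b, lin_indep2 a b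
      & forall x, P x -> exists s t : R, x = s *: a + t *: b].

(* X may be infinite-dimensional, so dim X >= 2 is the existence of two
   linearly independent vectors. Symmetry of perp is not assumed. *)
Record orthogonality_space (R : realType) (X : lmodType R)
    (perp : X -> X -> Prop) : Prop := OrthogonalitySpace {
  orth_dim : exists a b : X, lin_indep2 a b;
  orth_O1 : forall x : X, perp x 0 /\ perp 0 x;
  orth_O2 : forall x y : X, x <> 0 -> y <> 0 -> perp x y -> lin_indep2 x y;
  orth_O3 : forall x y : X, perp x y ->
    forall alpha beta : R, perp (alpha *: x) (beta *: y);
  orth_O4 : forall (P : set X) (x : X) (lambda : R),
    is_plane P -> P x -> 0 <= lambda ->
    exists y0 : X,
      [/\ P y0, perp x y0 & perp (x + y0) (lambda *: x - y0)]
}.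

Definition additive_map (U V : zmodType) (T : U -> V) : Prop :=
  forall x y : U, T (x + y) = T x + T y.

Definition quadratic_map (U V : zmodType) (Q : U -> V) : Prop :=
  forall x y : U, Q (x + y) + Q (x - y) = Q x *+ 2 + Q y *+ 2.

(* Main.v *)
(** Subtracting the constant [f2 0 + f3 0] from [f1] gives a map [F] with
    [|F (x + y) - F x - F y| <= 3 eps] for [x] orthogonal to [y], and [F] is
    within [eps] of each [fi - fi 0].  For an odd (even) [F], axiom (O4) with
    [lambda = 1] bounds [F (2 x) - 2 F x] (resp. [F (2 x) - 4 F x]), so Hyers'
    sequence [F (2^n x) / k^n] converges to an orthogonally additive map at
    distance at most [3 d] (resp. [7 d / 3]) when [F] has defect [d] (Ger and
    Sikorska).  Following Raetz, (O4) with arbitrary [lambda] shows that the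
    limit is additive (resp. quadratic) on every line; any two vectors are
    combinations of an orthogonal pair, so it is so everywhere.  The resulting
    constant is [16 / 3 * 3 + 1 = 17], below both [68 / 3] and [80 / 3].
    Uniqueness: a bounded map with [D (2 x) = k D x], [k >= 2], vanishes. *)

Require Import Defs.
From mathcomp Require Import all_boot all_order all_algebra.
From mathcomp Require Import all_classical all_reals all_analysis.
From mathcomp Require Import ring lra.

Set Implicit Arguments.
Unset Strict Implicit.
Unset Printing Implicit Defensive.

Import Order.TTheory GRing.Theory Num.Theory.
Import numFieldNormedType.Exports.

Local Open Scope classical_set_scope.
Local Open Scope ring_scope.

(** * Norm estimates, bounded eigenmaps and Hyers' direct method *)

Section Distance.
Variables (R : realType) (Y : normedModType R).
Implicit Types (a b c : Y) (d e : R).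

Lemma dist_trans b a c d e :
  `|a - b| <= d -> `|b - c| <= e -> `|a - c| <= d + e.
Proof. by move=> ab bc; apply: (le_trans (ler_distD b _ _)); apply: lerD. Qed.

Lemma dist_add a b a' b' d e :
  `|a - b| <= d -> `|a' - b'| <= e -> `|a + a' - (b + b')| <= d + e.
Proof.
by move=> ab ab'; rewrite opprD addrACA (le_trans (ler_normD _ _))// lerD.
Qed.

Lemma dist_opp a b d : `|a - b| <= d -> `|- a - - b| <= d.
Proof. by rewrite -opprD normrN. Qed.

Lemma dist_scale (k : R) a b d :
  `|a - b| <= d -> `|k *: a - k *: b| <= `|k| * d.
Proof. by move=> ab; rewrite -scalerBr normrZ ler_wpM2l. Qed.

Lemma geometric_bounded_eq0 (k C : R) a :
  2 <= k -> (forall n : nat, k ^+ n * `|a| <= C) -> a = 0.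
Proof.
move=> k2 bnd; apply/eqP; apply: contraT => a0.
have na : 0 < `|a| by rewrite normr_gt0.
have C0 : 0 <= C by apply: le_trans (bnd 0%N); rewrite mulr_ge0.
have := archi_boundP (divr_ge0 C0 (ltW na)); set n := Num.Def.archi_bound _.
rewrite ltr_pdivrMr// => Cn.
have nk : n%:R <= k ^+ n.
  apply: (@le_trans _ _ (2 ^+ n)); last by rewrite lerXn2r// ?nnegrE; lra.
  by rewrite -natrX ler_nat ltnW// ltn_expl.
have := lt_le_trans Cn (ler_wpM2r (ltW na) nk).
by rewrite ltNge bnd.
Qed.

(** Iterating [s] multiplies [D] by [k ^+ n] while the bound [C] persists. Taking orthogonality for
    [P] makes this apply to pairs of vectors as well as to single ones. *)
Lemma bounded_eigenmap_eq0 (Z : Type) (P : Z -> Prop) (s : Z -> Z)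
    (D : Z -> Y) (k C : R) :
  2 <= k -> (forall z, P z -> P (s z)) ->
  (forall z, P z -> D (s z) = k *: D z) ->
  (forall z, P z -> `|D z| <= C) -> forall z, P z -> D z = 0.
Proof.
move=> k2 Ps Ds DC z Pz; apply: (@geometric_bounded_eq0 k C) => // n.
elim: n z Pz => [|n IHn] z Pz; first by rewrite mul1r DC.
have k0 : 0 <= k by lra.
have Dk : k * `|D z| = `|D (s z)| by rewrite Ds// normrZ ger0_norm.
by rewrite exprSr -mulrA Dk IHn//; exact: Ps.
Qed.

End Distance.

(** Consecutive terms of [h (s^n z) / k^n] differ by at most [d / k^(n+1)], so the sequence
    converges and its total displacement is at most the geometric sum [d / (k - 1)]. *)
Lemma hyers_limit (R : realType) (Y : completeNormedModType R) (Z : Type)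
    (s : Z -> Z) (h : Z -> Y) (k d : R) :
  1 < k -> (forall z, `|h (s z) - k *: h z| <= d) ->
  exists g : Z -> Y, (forall z, g (s z) = k *: g z) /\
    (forall z, `|h z - g z| <= d / (k - 1)).
Proof.
move=> k1 hd; have k0 : 0 < k by lra.
pose u z n := k ^- n *: h (iter n s z).
have ku n : 0 <= k ^- n by rewrite invr_ge0 exprn_ge0// ltW.
have du z n : `|u z n.+1 - u z n| <= d * k^-1 * k^-1 ^+ n.
  have -> : u z n = k ^- n.+1 *: (k *: h (iter n s z)).
    by rewrite scalerA exprSr invfM divfK ?gt_eqF.
  apply: (le_trans (dist_scale _ (hd _))).
  by rewrite ger0_norm// exprSr invfM exprVn mulrC mulrA mulrAC.
have cu z : cvgn (u z).
  have -> : u z = (fun n => u z 0%N + series (telescope (u z)) n).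
    by apply/funext => n; rewrite -eq_sum_telescope.
  apply: is_cvgD; first exact: is_cvg_cst.
  apply: normed_cvg.
  apply: (@series_le_cvg _ _ (geometric (d * k^-1) k^-1)) => [n|n|n|].
  - exact: normr_ge0.
  - exact: le_trans (du z n).
  - exact: du.
  - apply: is_cvg_geometric_series.
    by rewrite ger0_norm ?invr_ge0 ?ltW// invf_lt1.
(* The right-hand side is the exact partial geometric sum, so the induction step ends in an
   equality. *)
have bu z n : `|h z - u z n| <= d / (k - 1) * (1 - k^-1 ^+ n).
  elim: n => [|n IHn].
    by rewrite /u expr0 invr1 scale1r subrr normr0 subrr mulr0.
  have := du z n; rewrite distrC => dun.
  apply: (le_trans (dist_trans IHn dun)).
  rewrite le_eqVlt; apply/orP; left; apply/eqP.
  by rewrite exprS; field; lra.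
exists (fun z => limn (u z)); split=> z.
- apply: cvg_lim => //.
  have -> : u (s z) = k \*: (fun n => u z n.+1).
    apply/funext => n /=; rewrite /u -iterSr scalerA exprS invfM mulrA.
    by rewrite divff ?gt_eqF// mul1r.
  by apply: cvgZl_tmp; rewrite cvg_shiftS; exact: cu.
- have c : `|h z - u z n| @[n --> \oo] --> `|h z - limn (u z)|.
    by apply: cvg_norm; apply: cvgB; [exact: cvg_cst|exact: cu].
  rewrite -(cvg_lim _ c)//.
  apply: limr_le; first by apply/cvg_ex; eexists; exact: c.
  near=> n; apply: (le_trans (bu z n)).
  have d0 : 0 <= d by exact: le_trans (hd z).
  apply: ler_piMr; first by apply: divr_ge0 => //; lra.
  by rewrite lerBlDr lerDl exprn_ge0// invr_ge0 ltW.
Unshelve. all: by end_near. Qed.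

(** * Geometry of orthogonality spaces *)

Section Orthogonality.
Variables (R : realType) (X : lmodType R) (perp : X -> X -> Prop).
Hypothesis hX : orthogonality_space perp.
Implicit Types (x y u v : X).

Lemma not_lin_indep2_scale x v :
  x <> 0 -> ~ lin_indep2 x v -> exists c : R, v = c *: x.
Proof.
move=> x0; apply: contra_notP => nv s t /eqP; rewrite addr_eq0 => /eqP st.
have t0 : t = 0.
  apply: contrapT => /eqP t0; apply: nv; exists (- t^-1 * s).
  by rewrite -scalerA st scaleNr scalerN opprK scalerA mulVf// scale1r.
split=> //; move/eqP: st; rewrite t0 scale0r oppr0 scaler_eq0.
by case/orP => /eqP.
Qed.

Lemma exists_lin_indep2 x : x <> 0 -> exists v, lin_indep2 x v.
Proof.
move=> x0; have [a [b ab]] := orth_dim hX.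
apply: contrapT => nex.
have nx v : exists c : R, v = c *: x.
  by apply: not_lin_indep2_scale => // xv; apply: nex; exists v.
have [[c ea] [d eb]] := (nx a, nx b).
(* The relation [d a - c b = 0] between two multiples of [x] contradicts the independence of [a] and
   [b]. *)
have [d0 c0] : d = 0 /\ - c = 0.
  by apply: ab; rewrite ea eb !scalerA mulNr scaleNr mulrC subrr.
have [] : (1 : R) = 0 /\ (1 : R) = 0; last by move/eqP; rewrite oner_eq0.
by apply: ab; rewrite ea eb d0 -(opprK c) c0 oppr0 !scale0r !scaler0 addr0.
Qed.

Lemma is_plane_span u v : lin_indep2 u v ->
  is_plane [set x : X | exists s t : R, x = s *: u + t *: v].
Proof.
move=> uv; split; first split.
- by exists 0, 0; rewrite !scale0r addr0.
- move=> _ _ [s [t ->]] [s' [t' ->]]; exists (s + s'), (t + t').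
  by rewrite !scalerDl addrACA.
- move=> a _ [s [t ->]]; exists (a * s), (a * t).
  by rewrite scalerDr !scalerA.
- exists u, v; split=> //.
  + by exists 1, 0; rewrite scale1r scale0r addr0.
  + by exists 0, 1; rewrite scale1r scale0r add0r.
Qed.

Lemma orth_O4_vector x (l : R) : 0 <= l ->
  exists2 y, perp x y & perp (x + y) (l *: x - y).
Proof.
move=> l0; have [->|/eqP x0] := eqVneq x 0.
  by exists 0; rewrite ?scaler0 ?subrr ?addr0; exact: (orth_O1 hX 0).1.
have [v xv] := exists_lin_indep2 x0.
have [|y [_ xy xyl]] := orth_O4 hX (x := x) (is_plane_span xv) _ l0.
  by exists 1, 0; rewrite scale1r scale0r addr0.
by exists y.
Qed.

(** For independent [u], [v], (O4) in their span gives [y] orthogonal to [u], and [u], [y] still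
    span [v]; a dependent pair uses a frame with one zero vector. This reduces identities in two
    vectors to identities on lines. *)
Lemma orth_frame u v : exists x y (a b c d : R),
  [/\ perp x y, u = a *: x + b *: y & v = c *: x + d *: y].
Proof.
have [->|/eqP u0] := eqVneq u 0.
  exists v, 0, 0, 0, 1, 0; split; first exact: (orth_O1 hX v).1.
  - by rewrite scale0r scaler0 addr0.
  - by rewrite scale1r scaler0 addr0.
have [uv|/(not_lin_indep2_scale u0)[c ->]] := pselect (lin_indep2 u v);
  last first.
  exists u, 0, 1, 0, c, 0; split; first exact: (orth_O1 hX u).1.
  - by rewrite scale1r scaler0 addr0.
  - by rewrite scaler0 addr0.
have [|y [[s [t ey]] uy uy1]] := orth_O4 hX (x := u) (is_plane_span uv) _ ler01.
  by exists 1, 0; rewrite scale1r scale0r addr0.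
(* If [y = 0], the second relation of (O4) would say that [u] is orthogonal to itself, against
   (O2). *)
have y0 : y <> 0.
  move=> y0; move: uy1; rewrite y0 scale1r addr0 subr0.
  move=> /(orth_O2 hX u0 u0)/(_ 1 (-1)) [].
    by rewrite scaleN1r scale1r subrr.
  by move/eqP; rewrite oner_eq0.
have t0 : t != 0.
  apply/eqP => t0; have [] := orth_O2 hX u0 y0 uy (s := - s) (t := 1).
    by rewrite ey t0 scale0r addr0 scale1r scaleNr addNr.
  by move=> _ /eqP; rewrite oner_eq0.
(* The coordinates of [v] come from solving [y = s u + t v]. *)
exists u, y, 1, 0, (- t^-1 * s), t^-1; split=> //.
- by rewrite scale1r scale0r addr0.
- by rewrite ey scalerDr !scalerA mulNr scaleNr addKr mulVf// scale1r.
Qed.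

Lemma orth_oppr x y : perp x y -> perp x (- y).
Proof. by move=> /(orth_O3 hX)/(_ 1 (-1)); rewrite scale1r scaleN1r. Qed.

Lemma orth_opp x y : perp x y -> perp (- x) (- y).
Proof. by move=> /(orth_O3 hX)/(_ (-1) (-1)); rewrite !scaleN1r. Qed.

Lemma orth_scale2 (c : R) x y : perp x y -> perp (c *: x) (c *: y).
Proof. by move=> /(orth_O3 hX). Qed.

(** * Exact orthogonally additive maps *)

Section OrthogonallyAdditive.
Variables (Y : lmodType R) (g : X -> Y).
Hypothesis gD : forall x y, perp x y -> g (x + y) = g x + g y.

Lemma orth_additive0 : g 0 = 0.
Proof.
apply: (addrI (g 0)).
by rewrite addr0 -[in RHS](addr0 0) gD//; exact: (orth_O1 hX 0).1.
Qed.

(** By (O4), [(1 + l) x] is the orthogonal sum of [x + y] and [l x - y]; after expansion [g y] and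
    [g (- y)] cancel. Rescaling [x] treats nonnegative coefficients, and oddness the other signs. *)
Lemma odd_orth_additive_line : (forall x, g (- x) = - g x) ->
  forall x (a b : R), g ((a + b) *: x) = g (a *: x) + g (b *: x).
Proof.
move=> gN; have ray x (l : R) : 0 <= l -> g ((1 + l) *: x) = g x + g (l *: x).
  move=> l0; have [y xy xyl] := orth_O4_vector x l0.
  have -> : (1 + l) *: x = (x + y) + (l *: x - y).
    by rewrite addrACA subrr addr0 scalerDl scale1r.
  rewrite (gD xyl) (gD xy) gD; last first.
    by apply: orth_oppr; rewrite -(scale1r y); exact: (orth_O3 hX).
  by rewrite gN addrACA subrr addr0.
have pos x (a b : R) : 0 <= a -> 0 <= b ->
    g ((a + b) *: x) = g (a *: x) + g (b *: x).
  rewrite le_eqVlt => /predU1P[<- _|a0 b0].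
    by rewrite scale0r orth_additive0 !add0r.
  have := ray (a *: x) (b / a) (divr_ge0 b0 (ltW a0)).
  by rewrite !scalerA mulrDl mul1r divfK ?gt_eqF.
have neg x (a b : R) : a <= 0 -> b <= 0 ->
    g ((a + b) *: x) = g (a *: x) + g (b *: x).
  move=> a0 b0; have := pos (- x) (- a) (- b).
  by rewrite !oppr_ge0 -opprD !scalerN !scaleNr !opprK; exact.
(* Moving one term across the equation leaves coefficients of equal sign: [a = (a + b) + (- b)] or
   [b = (a + b) + (- a)], according to the sign of [a + b]. *)
have mix x (a b : R) : 0 <= a -> b <= 0 ->
    g ((a + b) *: x) = g (a *: x) + g (b *: x).
  move=> a0 b0; have [ab|/ltW ab] := leP 0 (a + b).
    have := pos x (a + b) (- b); rewrite addrK oppr_ge0 => -> //.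
    by rewrite scaleNr gN subrK.
  have := neg x (a + b) (- a); rewrite (addrC (a + b)) addKr oppr_le0 => -> //.
  by rewrite scaleNr gN addrCA addrN addr0.
move=> x a b; have [a0|/ltW a0] := leP 0 a; have [b0|/ltW b0] := leP 0 b.
- exact: pos.
- exact: mix.
- by rewrite addrC mix// addrC.
- exact: neg.
Qed.

Lemma odd_orth_additive_additive :
  (forall x, g (- x) = - g x) -> additive_map g.
Proof.
move=> gN u v; have [x [y [a [b [c [d [xy -> ->]]]]]]] := orth_frame u v.
have gxy p q : g (p *: x + q *: y) = g (p *: x) + g (q *: y).
  by rewrite gD//; exact: (orth_O3 hX).
by rewrite addrACA -!scalerDl !gxy !odd_orth_additive_line// addrACA.
Qed.

(** With [y] from (O4), the sum and the difference of the orthogonal vectors [x + y] and [l x - y]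
    are [(1 + l) x] and [(1 - l) x + 2 y]. By evenness [g] agrees on both; adding the two expansions
    cancels [4 g y], which is [g (2 y)]. *)
Lemma even_orth_additive_line :
  (forall x, g (- x) = g x) -> (forall x, g (2 *: x) = 4 *: g x) ->
  forall x (a b : R),
    g ((a + b) *: x) + g ((a - b) *: x) = g (a *: x) *+ 2 + g (b *: x) *+ 2.
Proof.
move=> gN g2.
have ray x (l : R) : 0 <= l ->
    g ((1 + l) *: x) + g ((1 - l) *: x) = g x *+ 2 + g (l *: x) *+ 2.
  move=> l0; have [y xy xyl] := orth_O4_vector x l0.
  have lxy : perp (l *: x) y by rewrite -(scale1r y); exact: (orth_O3 hX).
  have E : g (x + y) + g (l *: x - y) = g x + g (l *: x) + g y *+ 2.
    by rewrite (gD xy) (gD (orth_oppr lxy)) gN addrACA -mulr2n.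
  have E1 : g ((1 + l) *: x) = g x + g (l *: x) + g y *+ 2.
    rewrite -E -(gD xyl); congr g.
    by rewrite addrACA subrr addr0 scalerDl scale1r.
  (* [E] evaluated a second time, along the pair [x + y], [- (l *: x - y)]. *)
  have E2 : g ((1 - l) *: x) + g y *+ 4 = g x + g (l *: x) + g y *+ 2.
    rewrite -E -(gN (l *: x - y)) -(gD (orth_oppr xyl)).
    rewrite -(scaler_nat 4) -g2 -gD; last exact: (orth_O3 hX).
    congr g; rewrite opprB (addrC y) addrACA scalerBl scale1r; congr (_ + _).
    by rewrite scaler_nat mulr2n.
  apply: (addIr (g y *+ 4)); rewrite -addrA E2 E1 -!mulrnDl.
  by rewrite addrACA -!mulr2n -mulrnA.
move=> x a b; have [->|a0] := eqVneq a 0.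
  by rewrite scale0r orth_additive0 mul0rn !add0r scaleNr gN.
(* A negative ratio only swaps the two summands on the left, and evenness absorbs the sign on the
   right. *)
have key := ray (a *: x) `|b / a| (normr_ge0 _).
have [ba|ba] := leP 0 (b / a); move: key.
  by rewrite ger0_norm// !scalerA mulrDl mulrBl mul1r divfK.
rewrite ltr0_norm// !scalerA opprK mulrBl mulrDl mul1r mulNr divfK//.
by rewrite scaleNr gN (addrC (g _)).
Qed.

Lemma even_orth_additive_quadratic :
  (forall x, g (- x) = g x) -> (forall x, g (2 *: x) = 4 *: g x) ->
  quadratic_map g.
Proof.
move=> gN g2 u v; have [x [y [a [b [c [d [xy -> ->]]]]]]] := orth_frame u v.
have gxy p q : g (p *: x + q *: y) = g (p *: x) + g (q *: y).
  by rewrite gD//; exact: (orth_O3 hX).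
rewrite opprD (addrACA _ _ (c *: x)) (addrACA _ _ (- (c *: x))).
rewrite -!scaleNr -!scalerDl !gxy.
by rewrite addrACA !even_orth_additive_line// addrACA -!mulrnDl.
Qed.

End OrthogonallyAdditive.

(** * Stability of orthogonal additivity *)

Section OrthogonalStability.
Variable Y : completeNormedModType R.
Implicit Types (f h : X -> Y) (d : R).

(** For the Hyers limit [g], the defects of additivity on orthogonal pairs and of parity are
    bounded, because [g] is close to [h], and are multiplied by [k] under doubling; hence they
    vanish. The sign [sg] covers odd and even maps together. *)
Lemma orth_hyers h (k sg d e : R) : 2 <= k ->
  (forall x y, perp x y -> `|h (x + y) - (h x + h y)| <= d) ->
  (forall x, h (- x) = sg *: h x) ->
  (forall x, `|h (2 *: x) - k *: h x| <= e) ->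
  exists g : X -> Y, [/\ forall x y, perp x y -> g (x + y) = g x + g y,
    forall x, g (- x) = sg *: g x, forall x, g (2 *: x) = k *: g x &
    forall x, `|h x - g x| <= e / (k - 1)].
Proof.
move=> k2 hD hN h2; have k1 : 1 < k by lra.
have [g [gk hg]] := hyers_limit k1 h2.
have gh x : `|g x - h x| <= e / (k - 1) by rewrite distrC.
exists g; split=> // [x y xy|x]; apply/eqP; rewrite -subr_eq0; apply/eqP.
- pose s (z : X * X) := (2 *: z.1, 2 *: z.2).
  apply: (@bounded_eigenmap_eq0 _ Y _ (fun z => perp z.1 z.2) s
    (fun z => g (z.1 + z.2) - (g z.1 + g z.2)) k
    (e / (k - 1) + (d + (e / (k - 1) + e / (k - 1)))) _ _ _ _ (x, y)) => //= z.
  + exact: orth_scale2.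
  + by rewrite -scalerDr !gk -scalerDr -scalerBr.
  + move=> zz; apply: dist_trans (gh _) (dist_trans (hD _ _ zz) _).
    exact: dist_add.
- apply: (@bounded_eigenmap_eq0 _ Y _ (fun=> True) ( *:%R 2)
    (fun z => g (- z) - sg *: g z) k
    (e / (k - 1) + `|sg| * (e / (k - 1))) _ _ _ _ x) => //= z _.
  + by rewrite -scalerN !gk scalerBr !scalerA (mulrC sg).
  + by apply: dist_trans (gh _) _; rewrite hN; exact: dist_scale.
Qed.

Lemma odd_orth_stability h d : (forall x, h (- x) = - h x) ->
  (forall x y, perp x y -> `|h (x + y) - (h x + h y)| <= d) ->
  exists2 T : X -> Y, additive_map T & forall x, `|h x - T x| <= 3 * d.
Proof.
move=> hN hD.
have [||x|x|g [gD gN _ hg]] := @orth_hyers h 2 (-1) d (3 * d) => //.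
- by rewrite hN scaleN1r.
- have [y xy xy1] := orth_O4_vector x ler01; rewrite scale1r in xy1.
  have -> : 2 *: x = (x + y) + (x - y).
    by rewrite addrACA subrr addr0 scaler_nat mulr2n.
  have -> : 2 *: h x = (h x + h y) + (h x + h (- y)).
    by rewrite hN addrACA subrr addr0 scaler_nat mulr2n.
  (* One [d] for splitting [(x + y) + (x - y)], then one for each of the two terms. *)
  have -> : 3 * d = d + (d + d) by ring.
  apply: dist_trans (hD _ _ xy1) _; apply: dist_add; first exact: hD.
  by apply: hD; exact: orth_oppr.
exists g => [|x].
  by apply: odd_orth_additive_additive => // x; rewrite gN scaleN1r.
by apply: le_trans (hg x) _; rewrite (_ : 2 - 1 = 1); [lra|ring].
Qed.

Lemma even_orth_stability h d : (forall x, h (- x) = h x) ->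
  (forall x y, perp x y -> `|h (x + y) - (h x + h y)| <= d) ->
  exists2 Q : X -> Y, quadratic_map Q & forall x, `|h x - Q x| <= 7 / 3 * d.
Proof.
move=> hN hD.
have [||x|x|g [gD gN g2 hg]] := @orth_hyers h 4 1 d (7 * d) => //.
- by lra.
- by rewrite hN scale1r.
- have [y xy xy1] := orth_O4_vector x ler01; rewrite scale1r in xy1.
  (* The half-sum [p] and half-difference [q] are orthogonal, [x = p + q] and [y = p - q]; by
     evenness both values lie within [d] of [h p + h q]. *)
  have hyx : `|h y - h x| <= d + d.
    pose p := 2^-1 *: (x + y); pose q := 2^-1 *: (x - y).
    have pq : perp p q := orth_scale2 2^-1 xy1.
    have half z : 2^-1 *: (z + z) = z :> X.
      by rewrite -mulr2n -(scaler_nat 2 z) scalerA mulVf ?scale1r// pnatr_eq0.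
    have ex : x = p + q.
      by rewrite -scalerDr addrACA subrr addr0 half.
    have ey : y = p - q.
      by rewrite -scalerBr opprB (addrC x) addrACA subrr addr0 half.
    apply: (@dist_trans _ _ (h p + h q)).
      by rewrite {1}ey -(hN q); apply: hD; exact: orth_oppr.
    by rewrite distrC {1}ex; exact: hD.
  have -> : 2 *: x = (x + y) + (x - y).
    by rewrite addrACA subrr addr0 scaler_nat mulr2n.
  have -> : 4 *: h x = (h x + h x) + (h x + h x).
    by rewrite scaler_nat (mulrnDr _ 2 2) mulr2n.
  (* One [d] for the outer splitting; each of [x + y] and [x - y] then costs [d], plus [2 d] for
     replacing [h y] by [h x]. *)
  have -> : 7 * d = d + ((d + (0 + (d + d))) + (d + (0 + (d + d)))) by ring.
  apply: dist_trans (hD _ _ xy1) _; apply: dist_add.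
    apply: dist_trans (hD _ _ xy) _.
    by apply: dist_add => //; rewrite subrr normr0.
  apply: dist_trans (hD _ _ (orth_oppr xy)) _.
  by rewrite hN; apply: dist_add => //; rewrite subrr normr0.
exists g => [|x].
  by apply: even_orth_additive_quadratic => // x; rewrite gN scale1r.
by apply: le_trans (hg x) _; rewrite (_ : 4 - 1 = 3); [lra|ring].
Qed.

(** The even and odd parts of [f] inherit the defect [d], since negation preserves orthogonality;
    their errors [7 / 3] and [3] add up to [16 / 3]. *)
Lemma orth_additive_stability f d :
  (forall x y, perp x y -> `|f (x + y) - (f x + f y)| <= d) ->
  exists Q T : X -> Y, [/\ quadratic_map Q, additive_map T &
    forall x, `|f x - (Q x + T x)| <= 16 / 3 * d].
Proof.
move=> fD.
pose fe x := 2^-1 *: (f x + f (- x)); pose fo x := 2^-1 *: (f x - f (- x)).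
have dE : `|2^-1| * (d + d) = d by rewrite ger0_norm ?invr_ge0//; lra.
have fDN x y : perp x y -> `|f (- (x + y)) - (f (- x) + f (- y))| <= d.
  by move=> xy; rewrite opprD; apply: fD; exact: orth_opp.
have [|x y xy|Q qQ feQ] := @even_orth_stability fe d.
- by move=> x; rewrite /fe opprK addrC.
- rewrite -scalerDr -dE addrACA.
  apply: dist_scale; apply: dist_add; first exact: fD.
  exact: fDN.
have [|x y xy|T aT foT] := @odd_orth_stability fo d.
- by move=> x; rewrite /fo opprK -scalerN opprB.
- rewrite -scalerDr -dE addrACA -opprD.
  apply: dist_scale; apply: dist_add; first exact: fD.
  by apply: dist_opp; exact: fDN.
exists Q, T; split=> // x.
have -> : f x = fe x + fo x.
  rewrite /fe /fo -scalerDr addrACA subrr addr0 -mulr2n -(scaler_nat 2 (f x)).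
  by rewrite scalerA mulVf ?scale1r// pnatr_eq0.
rewrite (_ : 16 / 3 * d = 7 / 3 * d + 3 * d); first exact: dist_add.
by field.
Qed.

End OrthogonalStability.

End Orthogonality.

(** * Quadratic and additive maps, and uniqueness of the decomposition *)

Section QuadraticAdditive.
Variables (R : realType) (X : lmodType R).

Lemma quadratic_map0 (Y : lmodType R) (Q : X -> Y) : quadratic_map Q -> Q 0 = 0.
Proof.
move=> qQ; have := qQ 0 0; rewrite subr0 addr0 -mulr2n => /esym/eqP.
by rewrite -subr_eq0 addrK -scaler_nat scaler_eq0 pnatr_eq0 => /eqP.
Qed.

Lemma quadratic_mapN (Y : lmodType R) (Q : X -> Y) :
  quadratic_map Q -> forall x, Q (- x) = Q x.
Proof.
move=> qQ x; have := qQ 0 x.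
rewrite add0r sub0r quadratic_map0// mul0rn add0r mulr2n.
exact: addrI.
Qed.

Lemma quadratic_map2 (Y : lmodType R) (Q : X -> Y) :
  quadratic_map Q -> forall x, Q (2 *: x) = 4 *: Q x.
Proof.
move=> qQ x; have := qQ x x.
by rewrite subrr quadratic_map0// addr0 !scaler_nat -mulrnDr -mulr2n => ->.
Qed.

Lemma additive_mapN (Y : lmodType R) (T : X -> Y) :
  additive_map T -> forall x, T (- x) = - T x.
Proof.
move=> aT x; have T0 : T 0 = 0.
  by apply: (addrI (T 0)); rewrite -aT !addr0.
by apply/eqP; rewrite -addr_eq0 -aT addNr T0.
Qed.

Lemma additive_map2 (Y : lmodType R) (T : X -> Y) :
  additive_map T -> forall x, T (2 *: x) = 2 *: T x.
Proof. by move=> aT x; rewrite !scaler_nat !mulr2n aT. Qed.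

(** Comparing the estimates at [x] and [- x] separates the even part from the odd one. The
    differences [Q - Q'] and [T - T'] are then bounded and scale by [4] and [2] under doubling, so
    they vanish. *)
Lemma quadratic_additive_close_eq (Y : normedModType R) (C : R)
    (Q Q' T T' : X -> Y) :
  quadratic_map Q -> quadratic_map Q' -> additive_map T -> additive_map T' ->
  (forall x, `|Q x + T x - (Q' x + T' x)| <= C) -> Q = Q' /\ T = T'.
Proof.
move=> qQ qQ' aT aT' close.
have bnd (a b : Y) (k : R) : `|2 *: a - 2 *: b| <= k -> `|a - b| <= k.
  move=> ab; apply: le_trans ab; rewrite -scalerBr normrZ normr_nat.
  by rewrite ler_peMl// ler1n.
have closeN x : `|Q x - T x - (Q' x - T' x)| <= C.
  have := close (- x).
  rewrite (quadratic_mapN qQ) (quadratic_mapN qQ').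
  by rewrite (additive_mapN aT) (additive_mapN aT').
split; apply/funext => x; apply/eqP; rewrite -subr_eq0; apply/eqP.
- apply: (@bounded_eigenmap_eq0 _ Y _ (fun=> True) ( *:%R 2)
    (fun z => Q z - Q' z) 4 (C + C) _ _ _ _ x) => //= [|z _|z _].
  + by lra.
  + by rewrite !quadratic_map2// scalerBr.
  + apply: bnd; have := dist_add (close z) (closeN z).
    rewrite (addrACA (Q z)) (addrACA (Q' z)) !subrr !addr0.
    by rewrite !scaler_nat !mulr2n.
- apply: (@bounded_eigenmap_eq0 _ Y _ (fun=> True) ( *:%R 2)
    (fun z => T z - T' z) 2 (C + C) _ _ _ _ x) => //= z _.
  + by rewrite !additive_map2// scalerBr.
  + apply: bnd; have := dist_add (close z) (dist_opp (closeN z)).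
    rewrite (opprB (Q z)) (opprB (Q' z)) (addrC (Q z)) (addrC (Q' z)).
    rewrite (addrACA (T z)) (addrACA (T' z)) !subrr !addr0.
    by rewrite !scaler_nat !mulr2n.
Qed.

End QuadraticAdditive.

Theorem theorem3 (R : realType) (X : lmodType R) (perp : X -> X -> Prop)
    (Y : completeNormedModType R) (f1 f2 f3 : X -> Y) (eps : R)
    (hX : orthogonality_space perp)
    (hf : forall x y : X, perp x y -> `|f1 (x + y) - f2 x - f3 y| <= eps) :
  exists! QT : (X -> Y) * (X -> Y),
    [/\ quadratic_map QT.1, additive_map QT.2
      & forall x : X,
        [/\ `|f1 x - f1 0 - QT.1 x - QT.2 x| <= 68 / 3 * eps,
            `|f2 x - f2 0 - QT.1 x - QT.2 x| <= 80 / 3 * eps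
          & `|f3 x - f3 0 - QT.1 x - QT.2 x| <= 80 / 3 * eps]].
Proof.
have eps0 : 0 <= eps := le_trans (normr_ge0 _) (hf _ _ (orth_O1 hX 0).1).
(* With this constant, the pairs [(x, 0)], [(0, x)] and [(0, 0)] in [hf] compare [F] with the
   centred [f2], [f3] and [f1] respectively. *)
pose c := f2 0 + f3 0; pose F x := f1 x - c.
have F2 x : `|F x - (f2 x - f2 0)| <= eps.
  have := hf _ _ (orth_O1 hX x).1; rewrite addr0; congr (`|_| <= _).
  by rewrite /F opprD (addrA (f1 x)) opprB addrACA subrK addrA addrAC.
have F3 x : `|F x - (f3 x - f3 0)| <= eps.
  have := hf _ _ (orth_O1 hX x).2; rewrite add0r; congr (`|_| <= _).
  by rewrite /F opprD (addrA (f1 x)) opprB addrA subrK.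
have F1 x : `|F x - (f1 x - f1 0)| <= eps.
  have := hf _ _ (orth_O1 hX 0).2; rewrite add0r; congr (`|_| <= _).
  by rewrite /F opprB [RHS]addrC addrA subrK opprD addrA.
have FD x y : perp x y -> `|F (x + y) - (F x + F y)| <= 3 * eps.
  move=> xy; have -> : 3 * eps = eps + (eps + eps) by ring.
  (* The constants cancel, so the first distance is exactly the quantity bounded in [hf]; [F2] and
     [F3] give the other two [eps]. *)
  apply: (@dist_trans _ _ ((f2 x - f2 0) + (f3 y - f3 0))).
    have := hf _ _ xy; congr (`|_| <= _).
    by rewrite /F addrACA -opprD opprB addrA subrK opprD addrA.
  by apply: dist_add; rewrite distrC.
have [Q [T [qQ aT FQT]]] := orth_additive_stability hX FD.
have bnd (a : Y) x (C : R) : 17 * eps <= C ->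
    `|F x - a| <= eps -> `|a - Q x - T x| <= C.
  move=> eC Fa; rewrite distrC in Fa; rewrite -addrA -opprD.
  by apply: le_trans eC; apply: le_trans (dist_trans Fa (FQT x)) _; lra.
exists (Q, T); split=> /=.
  split=> // x; split; apply: bnd => //; try by lra.
move=> [Q' T'] [/= qQ' aT' QT'].
(* The bound passes from [Q + T] to [F], then to [f1 - f1 0], then to [Q' + T']. *)
have [|-> ->] // := @quadratic_additive_close_eq _ _ _
  (16 / 3 * (3 * eps) + (eps + 68 / 3 * eps)) Q Q' T T' qQ qQ' aT aT'.
move=> x; have [FQT' _ _] := QT' x; rewrite -addrA -opprD in FQT'.
apply: dist_trans (dist_trans (F1 x) FQT').
by rewrite distrC.
Qed.
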